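(* Let $\kappa<\lambda<\mu$ be regular cardinals and suppose $Snr(\mu,\lambda,\kappa)$ holds. If $\kappa^*$ is a regular cardinal with $\kappa<\kappa^*<\lambda$, then $Snr(\mu,\lambda,\kappa^* )$ holds.
   Context: For regular $\kappa<\lambda$, $T^\lambda_\kappa = \{\alpha<\lambda : {\rm cf}(\alpha)=\kappa\}$. For regular $\kappa<\lambda<\mu$, $Snr(\mu,\lambda,\kappa)$ means there is $F: T^\mu_\kappa\to\lambda$ such that for every $\alpha\in T^\mu_\lambda$ there is $C\subseteq\alpha$ closed unbounded in $\alpha$ with $F\restriction (C\cap T^\mu_\kappa)$ strictly increasing. *)

(* Defs.v *)
From mathcomp Require Import all_boot all_order.
From mathcomp Require Import boolp classical_sets functions cardinality wochoice.

Set Implicit Arguments.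
Unset Strict Implicit.
Unset Printing Implicit Defensive.

Local Open Scope order_scope.
Local Open Scope classical_set_scope.
Local Open Scope card_scope.

(* Ordinals are the elements of a totally ordered type [Ord], to be used only
   together with [well_order (<=%O : rel Ord)]: such an [Ord] is (isomorphic to)
   an arbitrary ordinal theta, its elements being the ordinals below theta, and
   every ordinal a is an element of some such [Ord], for instance a + 1.  All
   the notions below, at a given ordinal, depend only on smaller ordinals, hence
   not on the choice of [Ord]. *)

Section Ordinals.
Context {d : Order.disp_t} {Ord : orderType d}.
Implicit Types (a b c k l m : Ord) (A B C : set Ord) (f F : Ord -> Ord).

(* The von Neumann view of an ordinal as the set of its predecessors. *)
Definition oset a : set Ord := [set b | b < a].

(* With [b <= c], successor ordinals have cofinality 1. *)
Definition unbounded_in a A := forall b, b < a -> exists2 c, A c & b <= c.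

Definition has_cofinal_map a k :=
  exists f, set_fun (oset k) (oset a) f /\ unbounded_in a (f @` oset k).

(* The default [a] is never used when [Ord] is well-ordered, see [cfP]. *)
Definition cf a : Ord :=
  xget a [set k | has_cofinal_map a k /\
                  forall l, has_cofinal_map a l -> k <= l].

Definition is_cardinal a := forall b, b < a -> ~~ (oset b #= oset a).

Definition regular_cardinal a :=
  [/\ is_cardinal a, infinite_set (oset a) & cf a = a].

Definition T l k : set Ord := [set a | a < l /\ cf a = k].

(* Only suprema below [a] count: [sup C] itself may be [a]. *)
Definition closed_in a C :=
  forall B b, B `<=` C -> B !=set0 -> b < a -> supremums B b -> C b.

Definition club_in a C :=
  [/\ C `<=` oset a, closed_in a C & unbounded_in a C].

(* A function T m k -> l is given by a total [F], whose values outside [T m k]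
   are irrelevant. *)
Definition Snr m l k :=
  exists2 F, set_fun (T m k) (oset l) F &
    forall a, T m l a ->
      exists2 C, club_in a C &
        forall b c, (C `&` T m k) b -> (C `&` T m k) c -> b < c -> F b < F c.

Lemma cfP a : well_order (<=%O : rel Ord) ->
  has_cofinal_map a (cf a) /\ forall l, has_cofinal_map a l -> cf a <= l.
Proof.
move=> wo.
have Ha : has_cofinal_map a a.
  by exists id; split=> [//|b ltba]; exists b => //; exists b.
have [|k [[/asboolP Hk mink] _]] := wo (fun k => `[< has_cofinal_map a k >]).
  by exists a; apply/asboolP.
apply: (@xgetPex _ a [set k | has_cofinal_map a k /\ _]).
by exists k; split=> // l Hl; apply: mink; apply/asboolP.
Qed.

End Ordinals.

(* Main.v *)
Require Import Defs.
From mathcomp Require Import all_boot all_order.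
From mathcomp Require Import boolp classical_sets functions cardinality wochoice.

(** Let [F] witness [Snr mu lambda kappa].  For [b] of cofinality [kappa_star],
    let [G b] be the least [g < lambda] bounding [F] at the points of cofinality
    [kappa] of some club of [b].  If [F] is increasing on the points of
    cofinality [kappa] of a club [C] of [a], then [G] is increasing on the
    limits of [C] of cofinality [kappa_star]: for two such limits [b < c] there
    is [x] in [C] of cofinality [kappa] with [b <= x < c], and [G b <= F x]
    because [C] traces a club on [b]; a club of [c] attaining [G c] meets [C]
    above [x] in a point [y] of cofinality [kappa], so [F x < F y <= G c]. *)

Set Implicit Arguments.
Unset Strict Implicit.
Unset Printing Implicit Defensive.
Import Order.TTheory.
Local Open Scope order_scope.
Local Open Scope classical_set_scope.

Section Ordinals.
Context {d : Order.disp_t} {Ord : orderType d}.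
Context (Ord_wo : well_order (<=%O : rel Ord)).
Implicit Types (a b c k l m x y : Ord) (A B C D : set Ord) (f F : Ord -> Ord).

(** * Least elements, cofinality and limit ordinals *)

Lemma ex_least A : A !=set0 -> exists2 x, A x & forall y, A y -> x <= y.
Proof.
move=> [a Aa]; have [|x [[/asboolP Ax minx] _]] := @Ord_wo (fun y => `[< A y >]).
  by exists a; apply/asboolP.
by exists x => // y Ay; apply/minx/asboolP.
Qed.

Lemma lt_wf : well_founded (fun x y : Ord => x < y).
Proof.
move=> a; apply: contrapT => naccA.
have [|x naccx minx] := @ex_least [set x | ~ Acc (fun x y : Ord => x < y) x].
  by exists a.
apply: naccx; constructor=> y ltyx; apply: contrapT => /minx.
by rewrite leNgt ltyx.
Qed.

Lemma bounded_of_lt_cf a k f : k < cf a -> set_fun (oset k) (oset a) f ->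
  exists2 b, b < a & forall x, x < k -> f x < b.
Proof.
move=> ltk fk; apply: contrapT => nbnd.
suff /(cfP a (@Ord_wo)).2 : has_cofinal_map a k by rewrite leNgt ltk.
exists f; split=> // b ltba; apply: contrapT => nfb.
apply: nbnd; exists b => // x ltxk; rewrite ltNge; apply/negP => lebf.
by apply: nfb; exists (f x) => //; exists x.
Qed.

Lemma cf_gt1_limit a k z x : z < k -> k < cf a -> x < a ->
  exists2 y, x < y & y < a.
Proof.
move=> ltzk ltk ltxa.
(* A constant map is bounded below [a]; [z] makes its domain nonempty, so that the bound exceeds
   [x]. *)
have [//|b ltba /(_ z ltzk) ltxb] := @bounded_of_lt_cf a k (fun=> x) ltk.
by exists b.
Qed.

Lemma infinite_oset_lt a : infinite_set (oset a) -> exists z, exists2 k, z < k & k < a.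
Proof.
move=> infa; have [z za] := infinite_setN0 infa.
apply: contrapT => na; apply: infa.
suff -> : oset a = [set z] by apply: finite_set1.
apply/seteqP; split=> [y ya|_ ->] //=.
case: (ltgtP y z) => // [ltyz|ltzy]; exfalso; apply: na.
- by exists y, z.
- by exists z, y.
Qed.

Lemma regular_limit k x : regular_cardinal k -> x < k -> exists2 y, x < y & y < k.
Proof.
move=> [_ /infinite_oset_lt [z [l ltzl ltlk]] cfk].
by apply: (@cf_gt1_limit k l z x) => //; rewrite cfk.
Qed.

Lemma regular_gt0 k : regular_cardinal k -> exists z, z < k.
Proof. by move=> [_ /infinite_oset_lt [z [l ltzl ltlk]] _]; exists l. Qed.

Lemma club_gt b x C : (forall y, y < b -> exists2 z, y < z & z < b) ->
  club_in b C -> x < b -> exists2 c, C c & x < c < b.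
Proof.
move=> limb [sC _ uC] /limb [y ltxy ltyb]; have [c Cc leyc] := uC y ltyb.
by exists c; rewrite // (lt_le_trans ltxy leyc); apply: sC.
Qed.

(** * Sequences shorter than the cofinality, and their suprema *)

Lemma strict_sup_sequence b k e : k < cf b -> (forall i, i < k -> e i < b) ->
  exists2 s, s < b & (forall i, i < k -> e i < s) /\
                     (forall x, x < s -> exists2 i, i < k & x <= e i).
Proof.
move=> ltk eb; have [u ub eu] := @bounded_of_lt_cf b k e ltk eb.
have [|s es mins] := @ex_least [set s | forall i, i < k -> e i < s].
  by exists u.
exists s; first exact: le_lt_trans (mins _ eu) ub.
split=> // x ltxs; apply: contrapT => nx.
suff /mins : forall i, i < k -> e i < x by rewrite leNgt ltxs.
by move=> i ik; rewrite ltNge; apply/negP => lex; apply: nx; exists i.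
Qed.

(** A cofinal map [f] from [cf s] to [s] transfers to [k]: sending [x] to an index [i] with
    [f x <= e i] is cofinal in [k], because [e] is increasing. Hence [k = cf k <= cf s]. *)
Lemma cf_sup_increasing_sequence k s (e : Ord -> Ord) : regular_cardinal k ->
    (forall i j, i < j -> j < k -> e i < e j) ->
    (forall i, i < k -> e i < s) ->
    (forall x, x < s -> exists2 i, i < k & x <= e i) ->
  cf s = k.
Proof.
move=> [_ _ cfk] einc es esup; apply/eqP; rewrite eq_le; apply/andP; split.
  apply: (cfP s (@Ord_wo)).2; exists e; split=> // x /esup [i ik xei].
  by exists (e i) => //; exists i.
have [[f [fs funb]] _] := cfP s Ord_wo; rewrite -[leLHS]cfk.
apply: (cfP k (@Ord_wo)).2.
have /choice [g gP] x : exists i, x < cf s -> i < k /\ f x <= e i.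
  have [xs|] := boolP (x < cf s); last by exists x.
  by have [i ? ?] := esup _ (fs _ xs); exists i.
exists g; split=> [x /gP []//|i ik].
have [_ [x xl <-] lefx] := funb _ (es _ ik).
have [gk fg] := gP _ xl; exists (g x); first by exists x.
rewrite leNgt; apply/negP => gi.
by have := le_lt_trans (le_trans lefx fg) (einc _ _ gi ik); rewrite ltxx.
Qed.

(** Transfinite recursion: at stage [i < k < cf b] the earlier values [n (e j)] are bounded below
    [b], so a next term exists and the default [x] is never taken. *)
Lemma ex_fast_sequence b k x n : k < cf b -> x < b ->
    (forall y, y < b -> exists2 z, y < z & z < b) ->
    (forall y, y < b -> n y < b) ->
  exists e, (forall i, i < k -> x < e i < b) /\
            (forall i j, i < j -> j < k -> n (e i) < e j).
Proof.
move=> ltk xb limb nb.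
pose ok (i : Ord) (r : forall j, j < i -> Ord) :=
  [set u | x < u < b /\ forall j (ji : j < i), n (r j ji) < u].
pose e := Fix lt_wf (fun=> Ord) (fun i r => xget x (ok i r)).
have eE i : e i = xget x (ok i (fun j _ => e j)).
  rewrite /e Fix_eq // => j r r' rr'; congr (xget x (ok j _)).
  by apply: functional_extensionality_dep => u; apply: functional_extensionality_dep.
suff eok i : i < k -> ok i (fun j _ => e j) (e i).
  exists e; split=> [i /eok []//|i j ij /eok [_]]; exact.
elim/(well_founded_ind lt_wf): i => i IH ik.
have [|u ub eu] := @bounded_of_lt_cf b i (n \o e) (lt_trans ik ltk).
  by move=> j ji; apply: nb; have [/andP[]] := IH j ji (lt_trans ji ik).
have [|v uxv vb] := limb (Order.max x u); first by rewrite gt_max xb.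
rewrite [e i]eE; apply: xgetI (v) _; split.
  by rewrite vb (le_lt_trans _ uxv) // le_max lexx.
by move=> j ji; apply: lt_trans (eu j ji) (le_lt_trans _ uxv); rewrite le_max lexx orbT.
Qed.

(** * Clubs: common points of given cofinality, limit points, traces *)

Lemma closed_in_sup b C s : club_in b C -> s < b ->
  (exists x, x < s) ->
  (forall x, x < s -> exists2 c, C c & x < c < s) -> C s.
Proof.
move=> [_ clC _] sb [x0 x0s] Cs; apply: (clC (C `&` oset s)) => //.
- by have [c Cc /andP[_ cs]] := Cs x0 x0s; exists c.
- split=> [c [_ /ltW]//|y uby]; rewrite leNgt; apply/negP => ys.
  have [c Cc /andP[yc cs]] := Cs y ys.
  by have := uby c (conj Cc cs); rewrite leNgt yc.
Qed.

(** Let [n y] lie beyond a point of [C] and a point of [D] that are both above [y]. A sequence of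
    length [k] that outruns [n] interleaves with both clubs, so its supremum lies in both and has
    cofinality [k]. *)
Lemma clubs_meet_cf b k x C D : regular_cardinal k -> k < cf b -> x < b ->
    club_in b C -> club_in b D ->
  exists2 s, C s /\ D s & x < s < b /\ cf s = k.
Proof.
move=> kreg ltk xb clC clD; have [z zk] := regular_gt0 kreg.
have limb y : y < b -> exists2 z, y < z & z < b by apply: cf_gt1_limit zk ltk.
have /choice [n nP] y : exists u, y < b ->
    [/\ u < b, exists2 c, C c & y < c <= u & exists2 c, D c & y < c <= u].
  have [yb|] := boolP (y < b); last by exists y.
  have [c Cc /andP[yc cb]] := club_gt limb clC yb.
  have [e De /andP[ye eb]] := club_gt limb clD yb.
  exists (Order.max c e) => _; split; first by rewrite gt_max cb.
  - by exists c => //; rewrite yc le_max lexx.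
  - by exists e => //; rewrite ye le_max lexx orbT.
have [|e [eb en]] := @ex_fast_sequence b k x n ltk xb limb.
  by move=> y /nP [].
have ebb i (ik : i < k) : e i < b by have /andP[] := eb i ik.
have einc i j : i < j -> j < k -> e i < e j.
  move=> ij jk; apply: lt_trans (en i j ij jk).
  have [_ [c _ /andP[ec cn]] _] := nP _ (ebb _ (lt_trans ij jk)).
  exact: lt_le_trans ec cn.
have limk i := @regular_limit k i kreg.
have [s sb [es esup]] := strict_sup_sequence ltk ebb.
have xs : x < s by have /andP[xe _] := eb z zk; apply: lt_trans xe (es z zk).
(* [E] stands for [C], then [D]. As [k] is a limit, some [j] follows [i], and the point of [E]
   between [e i] and [n (e i)] is below [e j], hence below [s]. *)
have meet E : (forall y, y < b -> exists2 c, E c & y < c <= n y) ->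
    forall y, y < s -> exists2 c, E c & y < c < s.
  move=> En y /esup [i ik yi]; have [j ij jk] := limk i ik.
  have [c Ec /andP[ec cn]] := En _ (ebb i ik); exists c => //.
  rewrite (le_lt_trans yi ec) (le_lt_trans cn) //.
  exact: lt_trans (en i j ij jk) (es j jk).
exists s; last by rewrite xs sb; split=> //; apply: cf_sup_increasing_sequence esup.
split.
- by apply: (closed_in_sup clC sb); [exists x | apply: meet => y /nP []].
- by apply: (closed_in_sup clD sb); [exists x | apply: meet => y /nP []].
Qed.

(* Besides the limit points of [C], this contains [0] and the successors of
   elements of [C]; they are harmless, not having infinite cofinality, and the
   successors make unboundedness in [a] immediate. *)
Definition limits a C : set Ord :=
  [set b | b < a /\ unbounded_in b (C `&` oset b)].

Lemma club_limits a C : (forall x, x < a -> exists2 y, x < y & y < a) ->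
  club_in a C -> club_in a (limits a C).
Proof.
move=> lima [sC clC uC]; split=> [b []//|B b sB _ ba [ubB lubB]|b ba].
  split=> // x xb.
  have [y By xy] : exists2 y, B y & x < y.
    apply: contrapT => nB; suff /lubB : ubound B x by rewrite leNgt xb.
    by move=> y By; rewrite leNgt; apply/negP => xy; apply: nB; exists y.
  have [_ /(_ _ xy) [c [Cc cy] xc]] := sB _ By.
  by exists c => //; split=> //; apply: lt_le_trans cy (ubB _ By).
have [c Cc bc] := uC _ ba; have [y cy ya] := lima _ (sC _ Cc).
have [|s cs mins] := @ex_least [set s | c < s]; first by exists y.
exists s; last exact: le_trans bc (ltW cs).
split; first exact: le_lt_trans (mins _ cy) ya.
move=> x xs; exists c => //; rewrite leNgt; apply/negP => /mins.
by rewrite leNgt xs.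
Qed.

Lemma club_trace a b C : club_in a C -> limits a C b -> club_in b (C `&` oset b).
Proof.
move=> [_ clC _] [ba ub]; split=> // B x sB B0 xb supB.
by split=> //; apply: clC supB => //; [move=> y /sB []|apply: lt_trans xb ba].
Qed.

(** * The function for the larger cofinality *)

Definition club_bound m l k F b : set Ord :=
  [set g | g < l /\ exists2 D, club_in b D &
                      forall x, (D `&` T m k) x -> F x <= g].

(** The default [k] keeps the values below [l] even where no bound exists, since [k < l] when this
    is applied. *)
Definition least_club_bound m l k F b : Ord :=
  xget k [set g | club_bound m l k F b g /\
                  forall h, club_bound m l k F b h -> g <= h].

Lemma least_club_boundP m l k F b g : club_bound m l k F b g ->
  club_bound m l k F b (least_club_bound m l k F b) /\
  least_club_bound m l k F b <= g.
Proof.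
move=> gP; have [|u uP minu] := @ex_least (club_bound m l k F b).
  by exists g.
rewrite /least_club_bound; case: xgetP => [_ -> [vP minv]|/(_ u) []//].
by split=> //; apply: minv.
Qed.

Lemma Snr_cofinality m l k k' : regular_cardinal k -> k < k' -> k' < l ->
  Snr m l k -> Snr m l k'.
Proof.
move=> kreg kk' k'l [F Fl Finc]; have kl := lt_trans kk' k'l.
exists (least_club_bound m l k F).
  move=> b _; rewrite /oset/= /least_club_bound.
  by case: xgetP => [_ -> [[]]//|_].
move=> a [am cfa]; have [C clC CF] := Finc a (conj am cfa).
have ka : k < cf a by rewrite cfa.
have [z zk] := regular_gt0 kreg.
exists (limits a C).
  by apply: club_limits clC => x; apply: cf_gt1_limit zk ka.
have Gle b x : limits a C b -> C x -> T m k x -> b <= x ->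
    club_bound m l k F b (F x).
  move=> limb Cx Tx bx; split; first exact: Fl.
  exists (C `&` oset b); first exact: club_trace clC limb.
  by move=> y [[Cy yb] Ty]; apply: ltW; apply: CF => //; apply: lt_le_trans yb bx.
have Ccf b c : limits a C c -> cf c = k' -> b < c -> forall D, club_in c D ->
    exists y, [/\ C y, T m k y, D y, b < y & y < c].
  move=> limc cfc bc D clD; have kc : k < cf c by rewrite cfc.
  have [y [[Cy _] Dy] [/andP[xy yc] cfy]] :=
    clubs_meet_cf kreg kc bc (club_trace clC limc) clD.
  by exists y; split=> //; split=> //; apply: lt_trans yc (lt_trans limc.1 am).
move=> b c [limb _] [limc [_ cfc]] bc.
have [x [Cx Tx _ bx xc]] := Ccf b c limc cfc bc _ (club_trace clC limc).
have [_ Gb] := least_club_boundP (Gle b x limb Cx Tx (ltW bx)).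
apply: le_lt_trans Gb _.
(* The point [w] of [C] above [c] only shows that [c] has some club bound, so that the least one is
   attained on a club [D] of [c]. *)
have [w [Cw _] [/andP[cw wa] cfw]] := clubs_meet_cf kreg ka limc.1 clC clC.
have Tw : T m k w by split=> //; apply: lt_trans wa am.
have [[_ [D clD DF]] _] := least_club_boundP (Gle c w limc Cw Tw (ltW cw)).
have [y [Cy Ty Dy xy _]] := Ccf x c limc cfc xc D clD.
have Fxy : F x < F y by apply: CF.
by apply: lt_le_trans Fxy _; apply: DF.
Qed.

End Ordinals.

Theorem theorem4 (d : Order.disp_t) (Ord : orderType d)
    (Ord_wo : well_order (<=%O : rel Ord)) (kappa lambda mu : Ord)
    (kappa_reg : regular_cardinal kappa)
    (lambda_reg : regular_cardinal lambda)
    (mu_reg : regular_cardinal mu)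
    (lt_kappa_lambda : kappa < lambda) (lt_lambda_mu : lambda < mu)
    (snr : Snr mu lambda kappa)
    (kappa_star : Ord) (kappa_star_reg : regular_cardinal kappa_star)
    (lt_kappa_star : kappa < kappa_star)
    (lt_star_lambda : kappa_star < lambda) :
  Snr mu lambda kappa_star.
Proof.
exact (@Snr_cofinality _ _ Ord_wo _ _ _ _
  kappa_reg lt_kappa_star lt_star_lambda snr).
Qed.
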